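(* Let $\langle X,\tau,\tau_S\rangle$ be an S4-subordination space. Then the lattice of $\prec$-congruences of $\langle\mathrm{Clop}(X),\prec_S\rangle$ is isomorphic to the lattice of those subsets of $X$ which are closed subsets of the Stone space $\langle X,\tau\rangle$ and saturated with respect to the topology $\tau_S$.
   Context: Let $\langle X,\tau,\tau_S\rangle$ be a bitopological space (a set with two topologies). $\mathrm{Clop}(X)$ denotes the Boolean algebra of clopen subsets of $\langle X,\tau\rangle$; $\mathrm{int}_S$ denotes interior with respect to $\tau_S$. For $U,V\in\mathrm{Clop}(X)$, $U\prec_S V$ means $U\subseteq\mathrm{int}_S(V)$. For $x,y\in X$: $x\leq_S y$ iff for all $U\in\mathrm{Clop}(X)$, $x\in\mathrm{int}_S(U)$ implies $y\in\mathrm{int}_S(U)$; $x\triangleleft_S y$ iff for all $U\in\mathrm{Clop}(X)$, $x\in\mathrm{int}_S(U)$ implies $y\in U$. The space is an S4-subordination space if: (Sp1) $\langle X,\tau\rangle$ is a Stone space (compact, Hausdorff and totally disconnected); (Sp2) $\{\mathrm{int}_S(U):U\in\mathrm{Clop}(X)\}$ is a base for $\tau_S$; (Sp3) $\mathrm{int}_S(U)\in\tau$ for each $U\in\mathrm{Clop}(X)$; (Sp4) $\triangleleft_S\subseteq\leq_S$. A $\prec$-congruence of $\langle\mathrm{Clop}(X),\prec_S\rangle$ is a Boolean congruence $\theta$ of $\mathrm{Clop}(X)$ such that whenever $W\prec_S U$ and $(U,V)\in\theta$, there exists $K\in\mathrm{Clop}(X)$ with $K\prec_S V$ and $(W,K)\in\theta$.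 A subset $Y\subseteq X$ is saturated with respect to $\tau_S$ if $Y=\bigcap\{\mathrm{int}_S(U):Y\subseteq U\in\mathrm{Clop}(X)\}$.
   Formalization: The closed saturated subsets are ordered by reverse inclusion, while congruences are ordered by inclusion; with inclusion on both sides the claim fails, e.g. for the one-point compactification of the natural numbers with both topologies equal. *)

(* Defs.v *)
(* MathComp and MathComp-Analysis. *)
From HB Require Import structures.
From mathcomp Require Import all_boot all_order.
From mathcomp Require Import boolp classical_sets functions cardinality.
From mathcomp Require Import topology separation_axioms.

Set Implicit Arguments.
Unset Strict Implicit.
Unset Printing Implicit Defensive.

Import Order.TTheory.
Local Open Scope classical_set_scope.

Section LatticesAsPosets.

(* A set of elements of T, as a type ordered by the restriction of the order of
   T; on `set U` that order is inclusion, so a set of sets becomes the poset of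
   its members under inclusion. *)
Definition subposet d (T : porderType d) (A : set T) : Type := set_type A.

HB.instance Definition _ d (T : porderType d) (A : set T) :=
  SubChoice.copy (subposet A) {x : T | x \in A}.

HB.instance Definition _ d (T : porderType d) (A : set T) :=
  [SubChoice_isSubPOrder of subposet A by <: with d].

Definition is_lattice d (P : porderType d) : Prop :=
  forall x y : P,
    infimums [set x; y] !=set0 /\ supremums [set x; y] !=set0.

Definition lattice_isomorphism d d' (P : porderType d) (Q : porderType d')
    (f : P -> Q) : Prop :=
  [/\ bijective f,
      forall x y z : P, infimums [set x; y] z ->
                        infimums [set f x; f y] (f z)
    & forall x y z : P, supremums [set x; y] z ->
                        supremums [set f x; f y] (f z)].

Definition isomorphic_lattices d d' (P : porderType d) (Q : porderType d') :
    Prop :=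
  [/\ is_lattice P, is_lattice Q & exists f : P -> Q, lattice_isomorphism f].

End LatticesAsPosets.

(* `Topological T` is the class of topology structures on the type T, so that
   one carrier can bear two of them. *)
Record bitopologicalSpace := Bitopological {
  carrier :> Type;
  tau : Topological carrier;
  tauS : Topological carrier
}.

Definition space (X : bitopologicalSpace) : topologicalType :=
  Topological.Pack (tau X).
Definition spaceS (X : bitopologicalSpace) : topologicalType :=
  Topological.Pack (tauS X).

Section Subordination.
Variable X : bitopologicalSpace.
Implicit Types (U V W K Y : set X) (x y : X).

Definition Clop : set (set X) := @clopen (space X).

Definition intS U : set X := @interior (spaceS X) U.

Definition precS U V : Prop := U `<=` intS V.

Definition leS x y : Prop := forall U, Clop U -> intS U x -> intS U y.

Definition triS x y : Prop := forall U, Clop U -> intS U x -> U y.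

Definition stone_space (T : topologicalType) : Prop :=
  [/\ compact [set: T], hausdorff_space T & totally_disconnected [set: T]].

Record S4_subordination_space : Prop := {
  Sp1 : stone_space (space X);
  Sp2 : @basis (spaceS X) [set intS U | U in Clop];
  Sp3 : forall U, Clop U -> @open (space X) (intS U);
  Sp4 : forall x y, triS x y -> leS x y
}.

(* theta relates clopen sets only and is reflexive on those: it is a relation on
   Clop, encoded as a set of pairs of arbitrary subsets. *)
Record boolean_congruence (theta : set (set X * set X)) : Prop := {
  cong_Clop : forall U V, theta (U, V) -> Clop U /\ Clop V;
  cong_refl : forall U, Clop U -> theta (U, U);
  cong_sym : forall U V, theta (U, V) -> theta (V, U);
  cong_trans : forall U V W, theta (U, V) -> theta (V, W) -> theta (U, W);
  congI : forall U V U' V', theta (U, V) -> theta (U', V') ->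
    theta (U `&` U', V `&` V');
  congU : forall U V U' V', theta (U, V) -> theta (U', V') ->
    theta (U `|` U', V `|` V');
  congC : forall U V, theta (U, V) -> theta (~` U, ~` V)
}.

Definition prec_congruence (theta : set (set X * set X)) : Prop :=
  boolean_congruence theta /\
  forall W U V, Clop W -> Clop U -> Clop V ->
    precS W U -> theta (U, V) ->
    exists K, [/\ Clop K, precS K V & theta (W, K)].

(* The condition under the intersection is Y `<=` U, not Y `<=` intS U. *)
Definition saturatedS Y : Prop :=
  Y = \bigcap_(U in [set U | Clop U /\ Y `<=` U]) intS U.

Definition closed_saturated Y : Prop :=
  @closed (space X) Y /\ saturatedS Y.

Definition prec_congruences : set (set (set X * set X)) :=
  [set theta | prec_congruence theta].

Definition closed_saturated_sets : set (set X) :=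
  [set Y | closed_saturated Y].

End Subordination.

Arguments prec_congruences : clear implicits.
Arguments closed_saturated_sets : clear implicits.

(* Main.v *)
Require Import Defs.
From mathcomp Require Import all_boot all_order.
From mathcomp Require Import boolp classical_sets functions cardinality.
From mathcomp Require Import topology separation_axioms.

(** Stone duality matches a Boolean congruence [theta] of the algebra of clopen
    sets with a closed set [Y]: two clopen sets are congruent exactly when they
    have the same trace on [Y], and [Y] is recovered as the intersection of the
    clopen sets congruent to the whole space. Enlarging [Y] shrinks [theta], so
    this correspondence reverses inclusion; hence the dual order on the side of
    the closed sets. It remains to see that the compatibility of [theta] with
    the subordination corresponds to the saturation of [Y].

    For closed [Y], being saturated amounts to: every clopen [U] containing [Y]
    satisfies [Y `<=` intS U] ([saturatedSP]). If [theta] is a prec-congruence,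
    apply its condition to [setT], which is subordinate to itself, and to the
    pair [(setT, U)]: the clopen set it yields contains [Y] and lies in
    [intS U]. Conversely, let [Y] be saturated, let [W] be subordinate to [U],
    and let [U], [V] have the same trace on [Y]. The clopen set of the points at
    which [U] and [V] agree contains [Y], hence so does its [intS], and
    therefore [W `&` Y] is contained in [intS V]. As [intS V] is open in the
    Stone topology, compactness puts a clopen set between [W `&` Y] and
    [intS V]; cutting it down to [W] gives the required witness.

    Everything topological rests on separating a closed set from the complement
    of an open set containing it by a clopen set ([stone_clopen_between]), which
    is also what makes intersections of closed saturated sets saturated. Closed
    saturated sets are thus stable under binary unions and intersections, so they
    form a lattice, and an order isomorphism carries this structure over to the
    prec-congruences. *)

Set Implicit Arguments.
Unset Strict Implicit.
Unset Printing Implicit Defensive.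

Import Order.TTheory.
Local Open Scope classical_set_scope.

(** * Clopen separation in Stone spaces *)

(** If no member of the family were contained in [O], the differences
    [C `\` O] would generate a proper filter, whose cluster points lie in every
    member of the family but not in [O]. *)
Lemma compact_bigcap_subset_open (T : topologicalType) (D : set (set T))
    (O : set T) :
  compact [set: T] -> open O -> D !=set0 ->
  (forall C, D C -> closed C) -> setI_closed D ->
  \bigcap_(C in D) C `<=` O -> exists2 C, D C & C `<=` O.
Proof.
move=> cT oO [C0 DC0] Dcl DI DO; apply: contrapT => noC.
have FF : ProperFilter (filter_from D (fun C => C `\` O)).
  apply: filter_from_proper.
    apply: filter_from_filter; first by exists C0.
    move=> A B DA DB; exists (A `&` B); first exact: DI.
    by move=> x [[Ax Bx] Ox].
  move=> C DC; apply: contrapT => /nonemptyPn CO; apply: noC; exists C => //.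
  by move=> x Cx; apply: contrapT => Ox; have : (C `\` O) x by []; rewrite CO.
have [|p [_]] := cT _ FF; first by exists C0.
rewrite clusterE => pcl.
have pC C : D C -> (C `\` O) p.
  move=> DC; have /closure_id -> : closed (C `\` O).
    by rewrite setDE; apply: closedI; [exact: Dcl|exact: open_closedC].
  by apply: pcl; exists C.
by have [_ +] := pC _ DC0; apply; apply: DO => C /pC[].
Qed.

(** A relatively clopen part [A] of the quasi-component [Q] of [x] and its
    complement in [Q] are disjoint closed sets. Normality puts them into disjoint
    open sets, and by compactness some clopen neighbourhood of [x] is covered by
    these two; its part around [A] is then a clopen neighbourhood of [x]. *)
Lemma quasi_component_minimal (T : topologicalType) (x : T) (A O C : set T) :
  compact [set: T] -> hausdorff_space T ->
  let Q := \bigcap_(K in [set K | clopen K /\ K x]) K in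
  open O -> A = Q `&` O -> closed C -> A = Q `&` C -> A x -> Q `<=` A.
Proof.
move=> cT hT Q oO AO cC AC Ax.
have cQ : closed Q by apply: closed_bigI => K [[]].
have cA : closed A by rewrite AC; exact: closedI.
have cD : closed (Q `\` O).
  by rewrite setDE; apply: closedI => //; exact: open_closedC.
have [|N nN clN] := @compact_normal T hT cT A cA (~` (Q `\` O)).
- move=> y Ay; apply: open_nbhs_nbhs; split; first exact: closed_openC.
  by move: Ay; rewrite AO => -[Qy Oy] [].
have AN : A `<=` N° by move=> y Ay; exact: nN.
have oNc : open (~` closure N) by apply: closed_openC; exact: closed_closure.
have [|||||K [[oK cK] Kx] KN] := @compact_bigcap_subset_open T
    [set K | clopen K /\ K x] (N° `|` ~` closure N) cT.
- by apply: openU => //; exact: open_interior.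
- by exists setT; split => //; exact: clopenT.
- by move=> K [[]].
- by move=> K L [cK Kx] [cL Lx]; split => //; exact: clopenI.
- move=> y Qy; have [Oy|Oy] := pselect (O y); first by left; apply: AN; rewrite AO.
  by right=> /clN; apply; split.
(* Both descriptions of this set are needed: one shows it open, one closed. *)
have KNE : K `&` N° = K `&` closure N.
  apply/seteqP; split=> y [Ky Ny]; split=> //.
    by apply: subset_closure; exact: interior_subset.
  by case: (KN _ Ky).
have QN : Q `<=` K `&` N°.
  apply: bigcap_inf; split; last by split=> //; exact: AN.
  split; first by apply: openI => //; exact: open_interior.
  by rewrite KNE; apply: closedI => //; exact: closed_closure.
move=> y Qy; rewrite AO; split=> //; apply: contrapT => Oy.
have := QN _ Qy; rewrite KNE => -[_ /clN]; apply; split=> //.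
Qed.

(** In a compact Hausdorff space quasi-components are connected, so when the
    space is totally disconnected they are single points. *)
Lemma stone_zero_dimensional (T : topologicalType) :
  stone_space T -> zero_dimensional T.
Proof.
move=> [cT hT dT] x y /eqP xy; apply: contrapT => nU; apply: xy.
pose Q := \bigcap_(K in [set K | clopen K /\ K x]) K.
have Qx : Q x by move=> K [].
have Qy : Q y.
  by move=> K [cK Kx]; apply: contrapT => Ky; apply: nU; exists K.
suff /(connected_component_max Qx (@subsetT _ Q))/(_ y Qy) : connected Q.
  by rewrite dT//= => ->.
move=> B [b Bb] [O oO BO] [C cC BC].
have BQ : B `<=` Q by rewrite BO; exact: subIsetl.
apply/seteqP; split=> //; have [Bx|Bx] := pselect (B x).
  exact: (quasi_component_minimal cT hT oO BO cC BC).
have QCO : Q `&` ~` C = Q `&` ~` O.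
  have: Q `&` C = Q `&` O by rewrite -BO -BC.
  move=> /seteqP[CO OC]; apply/seteqP; split=> z [Qz nz]; split=> // zz.
    by apply: nz; have [] := OC z (conj Qz zz).
  by apply: nz; have [] := CO z (conj Qz zz).
have : Q `<=` Q `&` ~` C.
  apply: (quasi_component_minimal cT hT (closed_openC cC) erefl
    (open_closedC oO) QCO).
  by split=> // Cx; apply: Bx; rewrite BC.
by move=> /(_ b (BQ _ Bb))[_]; move: Bb; rewrite BC => -[].
Qed.

(** Clopen neighbourhoods of the points outside the closed set show that it is
    the intersection of its clopen supersets; compactness then applies to these
    supersets. *)
Lemma stone_clopen_between (T : topologicalType) (C O : set T) :
  stone_space T -> closed C -> open O -> C `<=` O ->
  exists K, [/\ clopen K, C `<=` K & K `<=` O].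
Proof.
move=> sT cC oO CO; have zT := stone_zero_dimensional sT.
case: sT => cT hT _.
have [||||K [cK CK] KO] := @compact_bigcap_subset_open T
    [set K | clopen K /\ C `<=` K] O cT oO; last by exists K.
- by exists setT; split => //; exact: clopenT.
- by move=> K [[]].
- move=> K L [cK CK] [cL CL]; split; first exact: clopenI.
  by move=> z Cz; split; [exact: CK|exact: CL].
- move=> y yK; apply: CO; apply: contrapT => Cy.
  have [|D [Dy cD] DC] := @zero_dimensional_cvg T y hT zT cT (~` C).
    by apply: open_nbhs_nbhs; split=> //; exact: closed_openC.
  apply: (yK (~` D)) => //; split; first exact: clopenC.
  by move=> z Cz /DC.
Qed.

(** * Boolean congruences and closed sets *)

Section Congruences.
Variable X : bitopologicalSpace.
Implicit Types (theta : set (set X * set X)) (U V W K Y : set X).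

Lemma ClopT : Clop (@setT X). Proof. exact: (@clopenT (space X)). Qed.

Lemma ClopI U V : Clop U -> Clop V -> Clop (U `&` V).
Proof. exact: (@clopenI (space X)). Qed.

Lemma ClopU U V : Clop U -> Clop V -> Clop (U `|` V).
Proof. exact: (@clopenU (space X)). Qed.

Lemma ClopC U : Clop U -> Clop (~` U).
Proof. exact: (@clopenC (space X)). Qed.

Definition trace_congruence Y : set (set X * set X) :=
  [set p | [/\ Clop p.1, Clop p.2 & p.1 `&` Y = p.2 `&` Y]].

Definition congruence_set theta : set X :=
  \bigcap_(U in [set U | theta (U, setT)]) U.

Lemma trace_congruence_boolean Y : boolean_congruence (trace_congruence Y).
Proof.
split.
- by move=> U V [].
- by move=> U cU.
- by move=> U V [].
- by move=> U V W [/= cU cV UV] [/= _ cW VW]; split=> //=; rewrite UV.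
- move=> U V U' V' [/= cU cV UV] [/= cU' cV' UV'].
  split=> /=; [exact: ClopI|exact: ClopI|].
  by rewrite -[Y]setIid setIACA UV UV' setIACA.
- move=> U V U' V' [/= cU cV UV] [/= cU' cV' UV'].
  by split=> /=; [exact: ClopU|exact: ClopU|rewrite !setIUl UV UV'].
- move=> U V [/= cU cV /seteqP[UV VU]]; split=> /=; [exact: ClopC|exact: ClopC|].
  apply/seteqP; split=> x [nx Yx]; split=> // xx; apply: nx.
    by have [] := VU x (conj xx Yx).
  by have [] := UV x (conj xx Yx).
Qed.

Lemma trace_congruenceS Y Y' :
  Y `<=` Y' -> trace_congruence Y' `<=` trace_congruence Y.
Proof.
move=> YY' [U V] [/= cU cV UV]; split=> //=.
by move/setIidr: YY' => <-; rewrite !setIA UV.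
Qed.

Lemma congruence_setS theta theta' :
  theta `<=` theta' -> congruence_set theta' `<=` congruence_set theta.
Proof. by move=> tt' x tx U /tt'; exact: tx. Qed.

Lemma closed_congruence_set theta :
  boolean_congruence theta -> @closed (space X) (congruence_set theta).
Proof.
by move=> bt; apply: (@closed_bigI (space X)) => U /(cong_Clop bt)[[]].
Qed.

Lemma trace_congruenceK Y : stone_space (space X) -> @closed (space X) Y ->
  congruence_set (trace_congruence Y) = Y.
Proof.
move=> sX cY; apply/seteqP; split=> x; last first.
  by move=> Yx U [/= _ _ /seteqP[_ /(_ x)]][].
move=> Ux; apply: contrapT => Yx.
have [||K [cK YK Kx]] := @stone_clopen_between (space X) Y (~` [set x]) sX cY.
- apply: closed_openC; apply: accessible_closed_set1.
  by apply: hausdorff_accessible; case: sX.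
- by move=> y Yy yx; apply: Yx; rewrite -yx.
apply: (Kx x) => //; apply: Ux; split=> //=; first exact: ClopT.
by rewrite setTI; exact/setIidr.
Qed.

(** The classes of the whole space form a filter of clopen sets with intersection
    [congruence_set theta]; by compactness that filter contains every clopen set
    which includes its intersection. *)
Lemma clopen_congruent_setT theta U :
  stone_space (space X) -> boolean_congruence theta -> Clop U ->
  congruence_set theta `<=` U -> theta (U, setT).
Proof.
move=> [cX _ _] bt cU tU.
have [|||||K tK KU] := @compact_bigcap_subset_open (space X)
    [set U | theta (U, setT)] U cX; [by case: cU| | | |exact: tU|].
- by exists setT; apply: cong_refl => //; exact: ClopT.
- by move=> K /(cong_Clop bt)[[]].
- move=> K L tK tL; rewrite /= -(setIid (@setT X)).
  exact: (congI bt tK tL).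
have := congU bt (cong_refl bt cU) tK.
by rewrite setUT; move/setUidPl: KU => ->.
Qed.

(** Two sets with the same trace on [congruence_set theta] agree on a clopen set
    congruent to the whole space, and meeting with that set makes them equal. *)
Lemma congruence_setK theta :
  stone_space (space X) -> boolean_congruence theta ->
  trace_congruence (congruence_set theta) = theta.
Proof.
move=> sX bt; apply/seteqP; split=> -[U V].
  move=> [/= cU cV /seteqP[UV VU]].
  pose E := (U `&` V) `|` (~` U `&` ~` V).
  have tE : theta (E, setT).
    apply: clopen_congruent_setT => //.
      by apply: ClopU; apply: ClopI => //; exact: ClopC.
    move=> x tx; have [Ux|Ux] := pselect (U x).
      by left; split=> //; have [] := UV x (conj Ux tx).
    by right; split=> // Vx; apply: Ux; have [] := VU x (conj Vx tx).
  have UE : U `&` E = V `&` E.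
    apply/seteqP; split=> x [Hx [[Ux Vx]|[Ux Vx]]]; split=> //; by [left|].
  have tUE W : Clop W -> theta (W `&` E, W).
    by move=> cW; have := congI bt (cong_refl bt cW) tE; rewrite setIT.
  apply: (cong_trans bt (cong_sym bt (tUE _ cU))).
  by rewrite UE; exact: tUE.
move=> tUV; have [cU cV] := cong_Clop bt tUV; split=> //=.
have sub U' V' : theta (U', V') ->
    U' `&` congruence_set theta `<=` V' `&` congruence_set theta.
  move=> t' x [Ux tx]; split=> //.
  have [cU' cV'] := cong_Clop bt t'.
  have /tx : theta (~` U' `|` V', setT).
    rewrite -(setUCl V'); apply: (congU bt); last exact: cong_refl.
    exact: (congC bt).
  by case.
by apply/seteqP; split; apply: sub => //; exact: (cong_sym bt).
Qed.

(** * Subordination and saturation *)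

Lemma intS_subset U : intS U `<=` U.
Proof. exact: (@interior_subset (spaceS X)). Qed.

Lemma intST : intS (@setT X) = setT.
Proof. exact: (@interiorT (spaceS X)). Qed.

Lemma intSS U V : U `<=` V -> intS U `<=` intS V.
Proof. exact: (@interiorS (spaceS X)). Qed.

Lemma intSI U V : intS (U `&` V) = intS U `&` intS V.
Proof. exact: (@interiorI (spaceS X)). Qed.

(** The reverse inclusion in the definition of saturation is automatic, because
    a closed set is the intersection of its clopen supersets. *)
Lemma saturatedSP Y : stone_space (space X) -> @closed (space X) Y ->
  saturatedS Y <-> forall U, Clop U -> Y `<=` U -> Y `<=` intS U.
Proof.
move=> sX cY; split.
  by move=> YE U cU YU; rewrite [Y]YE; exact: bigcap_inf.
move=> Ysat; apply/seteqP; split=> x.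
  by move=> Yx U [cU YU]; exact: Ysat Yx.
move=> Ux; rewrite -(trace_congruenceK sX cY) => U [/= cU _].
rewrite setTI => /setIidPr YU.
by apply: intS_subset; apply: Ux.
Qed.

Lemma prec_congruence_saturated theta : stone_space (space X) ->
  prec_congruence theta -> closed_saturated (congruence_set theta).
Proof.
move=> sX [bt pt]; have cY := closed_congruence_set bt.
split=> //; apply/saturatedSP => // U cU YU.
have tU : theta (setT, U).
  by apply: (cong_sym bt); exact: clopen_congruent_setT.
have [|K [cK KU tK]] := pt setT setT U ClopT ClopT cU _ tU.
  by rewrite /precS intST.
by move=> x Yx; apply: KU; apply: Yx; exact: (cong_sym bt).
Qed.

Lemma saturated_prec_congruence Y : stone_space (space X) ->
  (forall U, Clop U -> @open (space X) (intS U)) ->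
  closed_saturated Y -> prec_congruence (trace_congruence Y).
Proof.
move=> sX oS [cY /(saturatedSP sX cY) Ysat].
split; first exact: trace_congruence_boolean.
move=> W U V cW cU cV WU [/= _ _ /seteqP[UV VU]].
pose E := (~` U) `|` V.
have cE : Clop E by apply: ClopU => //; exact: ClopC.
have YE : Y `<=` E.
  move=> x Yx; have [Ux|Ux] := pselect (U x); last by left.
  by right; have [] := UV x (conj Ux Yx).
have WV : W `&` Y `<=` intS V.
  move=> x [Wx Yx]; have : intS (U `&` E) x.
    by rewrite intSI; split; [exact: WU|exact: (Ysat E)].
  by apply: intSS => z [Uz [|]].
have cWY : @closed (space X) (W `&` Y).
  by apply: (@closedI (space X)) => //; case: cW.
have [K [cK WK KV]] := stone_clopen_between sX cWY (oS _ cV) WV.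
have cKW : Clop (K `&` W) by exact: ClopI.
exists (K `&` W); split=> //; first by move=> x [/KV].
split=> //=; apply/seteqP; split=> x.
  by move=> [Wx Yx]; split=> //; split=> //; exact: WK.
by move=> [[]].
Qed.

Lemma closed_saturatedU Y Y' : stone_space (space X) ->
  closed_saturated Y -> closed_saturated Y' -> closed_saturated (Y `|` Y').
Proof.
move=> sX [cY /(saturatedSP sX cY) sY] [cY' /(saturatedSP sX cY') sY'].
have cU : @closed (space X) (Y `|` Y') by exact: (@closedU (space X)).
split=> //; apply/saturatedSP => // U cU' YU x.
by case; [apply: sY|apply: sY'] => // z Yz; apply: YU; [left|right].
Qed.

(** A clopen superset [U] of [Y `&` Y'] contains an intersection of clopen
    supersets of [Y] and of [Y']: separate [Y] from [Y' `\` U] by a clopen set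
    [K], and take [K] and [U `|` ~` K]. *)
Lemma closed_saturatedI Y Y' : stone_space (space X) ->
  closed_saturated Y -> closed_saturated Y' -> closed_saturated (Y `&` Y').
Proof.
move=> sX [cY /(saturatedSP sX cY) sY] [cY' /(saturatedSP sX cY') sY'].
have cI : @closed (space X) (Y `&` Y') by exact: (@closedI (space X)).
split=> //; apply/saturatedSP => // U cU YU.
have [||K [cK YK KU]] := @stone_clopen_between (space X) Y (~` (Y' `\` U)) sX cY.
- apply: closed_openC; rewrite setDE; apply: (@closedI (space X)) => //.
  by apply: open_closedC; case: cU.
- by move=> x Yx [Y'x Ux]; apply: Ux; exact: YU.
move=> x [Yx Y'x]; have : intS (K `&` (U `|` ~` K)) x.
  rewrite intSI; split; first exact: (sY K).
  apply: sY' => //; first by apply: ClopU => //; exact: ClopC.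
  move=> z Y'z; have [Kz|Kz] := pselect (K z); last by right.
  by left; apply: contrapT => Uz; apply: (KU z Kz).
by apply: intSS => z [Kz [|]].
Qed.

End Congruences.

(** * Lattices as posets *)

Lemma is_lattice_dual d (P : porderType d) : is_lattice P -> is_lattice P^d.
Proof. by move=> lP x y; have [] := lP x y. Qed.

Definition member d (T : porderType d) (A : set T) x (Ax : A x) : subposet A :=
  exist (fun y => y \in A) x (mem_set Ax).

Lemma memberP d (T : porderType d) (A : set T) (x : subposet A) : A (val x).
Proof. exact: set_mem (valP x). Qed.

Lemma is_lattice_subposet_set (T : Type) (A : set (set T)) :
  setI_closed A -> setU_closed A -> is_lattice (subposet A).
Proof.
move=> AI AU x y.
pose i := member (AI _ _ (memberP x) (memberP y)).
pose u := member (AU _ _ (memberP x) (memberP y)).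
split; [exists i|exists u]; split.
- by move=> z [->|->]; rewrite -Order.le_val subsetEset => ? [].
- move=> z zl; rewrite -Order.le_val subsetEset subsetI; split.
    by rewrite -subsetEset Order.le_val; apply: zl; left.
  by rewrite -subsetEset Order.le_val; apply: zl; right.
- by move=> z [->|->]; rewrite -Order.le_val subsetEset => ? ?; [left|right].
- move=> z zu; rewrite -Order.le_val subsetEset subUset; split.
    by rewrite -subsetEset Order.le_val; apply: zu; left.
  by rewrite -subsetEset Order.le_val; apply: zu; right.
Qed.

Lemma order_iso_infimums d d' (P : porderType d) (Q : porderType d')
    (f : P -> Q) (g : Q -> P) : cancel g f -> {mono f : x y / (x <= y)%O} ->
  forall (A : set P) z, infimums A z -> infimums (f @` A) (f z).
Proof.
move=> gK fm A z [zl zg]; split; first by move=> _ [x Ax <-]; rewrite fm; exact: zl.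
move=> b bl; rewrite -(gK b) fm; apply: zg => x Ax.
by rewrite -fm gK; apply: bl; exists x.
Qed.

Lemma order_iso_supremums d d' (P : porderType d) (Q : porderType d')
    (f : P -> Q) (g : Q -> P) : cancel g f -> {mono f : x y / (x <= y)%O} ->
  forall (A : set P) z, supremums A z -> supremums (f @` A) (f z).
Proof.
move=> gK fm A z; apply: (@order_iso_infimums _ _ P^d Q^d f g gK).
by move=> x y; exact: fm.
Qed.

Lemma order_iso_lattices d d' (P : porderType d) (Q : porderType d')
    (f : P -> Q) (g : Q -> P) :
  cancel f g -> cancel g f -> {homo f : x y / (x <= y)%O} ->
  {homo g : x y / (x <= y)%O} -> is_lattice Q -> isomorphic_lattices P Q.
Proof.
move=> fK gK fh gh lQ.
have fm : {mono f : x y / (x <= y)%O}.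
  by move=> x y; apply/idP/idP => [/gh|/fh//]; rewrite !fK.
have gm : {mono g : x y / (x <= y)%O}.
  by move=> x y; rewrite -fm !gK.
have im2 (S S' : Type) (h : S -> S') a b : h @` [set a; b] = [set h a; h b].
  by rewrite image_setU !image_set1.
split=> //; last first.
  exists f; split; first by exists g.
    by move=> x y z /(order_iso_infimums gK fm); rewrite im2.
  by move=> x y z /(order_iso_supremums gK fm); rewrite im2.
move=> x y; have [[i iP] [s sP]] := lQ (f x) (f y).
split; [exists (g i)|exists (g s)].
  by have := order_iso_infimums fK gm iP; rewrite im2 !fK.
by have := order_iso_supremums fK gm sP; rewrite im2 !fK.
Qed.

(** * The lattice of prec-congruences *)

Theorem corollary22 (X : bitopologicalSpace) (HX : S4_subordination_space X) :
  isomorphic_lattices (subposet (prec_congruences X))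
    (subposet (closed_saturated_sets X))^d.
Proof.
have sX := Sp1 HX.
pose P := subposet (prec_congruences X).
pose Q := subposet (closed_saturated_sets X).
have PP (t : P) : prec_congruence (val t) := memberP t.
have QP (Y : Q) : closed_saturated (val Y) := memberP Y.
pose f (t : P) : Q^d := member (prec_congruence_saturated sX (PP t)).
pose g (Y : Q^d) : P :=
  member (saturated_prec_congruence sX (Sp3 HX) (QP Y)).
apply: (@order_iso_lattices _ _ P Q^d f g).
- by move=> t; apply: val_inj; apply: congruence_setK => //; case: (PP t).
- by move=> Y; apply: (@val_inj _ _ Q); apply: trace_congruenceK => //;
    case: (QP Y).
- move=> t t'; rewrite leEdual -!Order.le_val !subsetEset.
  exact: congruence_setS.
- move=> Y Y'; rewrite leEdual -!Order.le_val !subsetEset.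
  exact: trace_congruenceS.
- apply: is_lattice_dual; apply: is_lattice_subposet_set.
    by move=> Y Y'; exact: closed_saturatedI.
  by move=> Y Y'; exact: closed_saturatedU.
Qed.
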